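(* Let $G$ be a finite group acting on an idempotent complete triangulated category $\mathcal{T}$ such that the equivariantization $\mathcal{T}^G$ carries a naturally induced triangulated structure, the functors $Ind:\mathcal{T}\to\mathcal{T}^G$ and $\mathscr{F}:\mathcal{T}^G\to\mathcal{T}$ are exact and satisfy $Ind\dashv\mathscr{F}\dashv Ind$, and every object $(A,\varphi)\in\mathcal{T}^G$ is a direct summand of $Ind(A)$. Suppose all thick subcategories of $\mathcal{T}^G$ are Ind-closed. Let $C$ be the set of $G$-Matsui primes of $\mathcal{T}$, $MSpc_G(\mathcal{T}):=Esp_C(\mathcal{T})$ and $C^G:=\{\mathcal{P}^G:\mathcal{P}\in C\}$. Then there is an immersion $$MSpc_G(\mathcal{T})=Esp_C(\mathcal{T})\cong Esp_{C^G}(\mathcal{T}^G)\hookrightarrow MSpc(\mathcal{T}^G)$$ (given by $\mathcal{P}\mapsto\mathcal{P}^G$), and it is a homeomorphism if and only if every Matsui prime of $\mathcal{T}^G$ is of the form $\mathcal{P}^G$ for some $G$-Matsui prime $\mathcal{P}$ of $\mathcal{T}$.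
   Context: An action of $G$ (identity $e$) on $\mathcal{T}$ consists of exact (triangulated) equivalences $T_g:\mathcal{T}\to\mathcal{T}$ ($g\in G$) and natural isomorphisms $\gamma_{g,h}:T_gT_h\to T_{gh}$ with $\gamma_{g,hk}\circ T_g\gamma_{h,k}=\gamma_{gh,k}\circ\gamma_{g,h}T_k$ for all $g,h,k$. A $G$-equivariant object is a pair $(E,\varphi)$ with $E\in\mathcal{T}$ and isomorphisms $\varphi_g:T_gE\to E$ such that $\varphi_{gh}\circ\gamma_{g,h}^E=\varphi_g\circ T_g\varphi_h$. The equivariantization $\mathcal{T}^G$ has these as objects and, as morphisms, the morphisms in $\mathcal{T}$ commuting with the $\varphi_g$'s; in its naturally induced triangulated structure a triangle is distinguished iff its image under $\mathscr{F}$ is. $\mathscr{F}(E,\varphi)=E$ is the forgetful functor and $Ind(A)=(\bigoplus_{g}T_gA,\tau^A)$ with $\tau^A_h=\bigoplus_g\gamma^A_{h,h^{-1}g}$. $Th(\mathcal{T})$ is the collection of thick subcategories of $\mathcal{T}$ (non-empty full triangulated subcategories closed under direct summands). A Matsui prime (prime thick subcategory) of a triangulated category $\mathcal{T}$ is a proper thick subcategory $\mathcal{P}\subsetneq\mathcal{T}$ such that the poset $\{\mathcal{N}\in Th(\mathcal{T}):\mathcal{P}\subsetneq\mathcal{N}\}$ has a smallest element. A subcategory $\mathcal{N}$ is $G$-invariant if $T_g(\mathcal{N})\subseteq\mathcal{N}$ for all $g\in G$; a $G$-Matsui prime is a $G$-invariant Matsui prime of $\mathcal{T}$. A subcategory $\mathcal{J}$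 of $\mathcal{T}^G$ is Ind-closed if $Ind(E)\in\mathcal{J}$ for every $(E,\varphi)\in\mathcal{J}$. $\mathcal{P}^G:=\{(E,\varphi)\in\mathcal{T}^G: E\in\mathcal{P}\}$. For a set $C$ of thick subcategories, $Esp_C$ is $C$ with the topology whose closed sets are $\{\mathcal{P}\in C:\mathcal{P}\cap\mathcal{X}=\emptyset\}$, $\mathcal{X}$ ranging over classes of objects. $MSpc(\mathcal{T}^G)$ is this space for the set of all Matsui primes of $\mathcal{T}^G$. An immersion is a homeomorphism onto its image with the subspace topology. *)

(* Defs.v *)
From HB Require Import structures.
From mathcomp Require Import all_boot all_algebra fingroup.
From mathcomp Require Import boolp classical_sets.
From mathcomp Require Import topology.

Set Implicit Arguments.
Unset Strict Implicit.
Unset Printing Implicit Defensive.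

Import GRing.Theory.
Local Open Scope classical_set_scope.
Local Open Scope ring_scope.

Declare Scope cat_scope.
Delimit Scope cat_scope with cat.

Record preaddCat := PreaddCat {
  obj :> Type;
  hom : obj -> obj -> zmodType;
  idm : forall X, hom X X;
  comp : forall X Y Z, hom Y Z -> hom X Y -> hom X Z;
  comp1m : forall X Y (f : hom X Y), comp (idm Y) f = f;
  compm1 : forall X Y (f : hom X Y), comp f (idm X) = f;
  compA : forall X Y Z W (h : hom Z W) (g : hom Y Z) (f : hom X Y),
    comp h (comp g f) = comp (comp h g) f;
  compDl : forall X Y Z (g g' : hom Y Z) (f : hom X Y),
    comp (g + g') f = comp g f + comp g' f;
  compDr : forall X Y Z (g : hom Y Z) (f f' : hom X Y),
    comp g (f + f') = comp g f + comp g f' }.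

Arguments hom {p} X Y.
Arguments idm {p} X.
Arguments comp {p X Y Z} g f.

Notation "g '∘' f" := (comp g f) (at level 40, left associativity) : cat_scope.
Local Open Scope cat_scope.

Definition is_iso (C : preaddCat) (X Y : C) (f : hom X Y) :=
  exists g : hom Y X, g ∘ f = idm X /\ f ∘ g = idm Y.

Definition is_zero (C : preaddCat) (Z : C) := idm Z = 0.

Record biproduct (C : preaddCat) (I : finType) (X : I -> C) := Biproduct {
  bp_obj :> C;
  bp_in : forall i, hom (X i) bp_obj;
  bp_out : forall i, hom bp_obj (X i);
  bp_same : forall i, bp_out i ∘ bp_in i = idm (X i);
  bp_diff : forall i j, i != j -> bp_out i ∘ bp_in j = 0;
  bp_sum : \sum_i bp_in i ∘ bp_out i = idm bp_obj }.

Arguments bp_in {C I X} b i.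
Arguments bp_out {C I X} b i.

(* The empty family gives a zero object. *)
Definition additive_cat (C : preaddCat) :=
  forall (I : finType) (X : I -> C), inhabited (biproduct X).

Definition direct_summand (C : preaddCat) (X Y : C) :=
  exists (Z : C) (i : hom X Y) (p : hom Y X) (j : hom Z Y) (q : hom Y Z),
    [/\ p ∘ i = idm X, q ∘ j = idm Z, p ∘ j = 0, q ∘ i = 0
      & i ∘ p + j ∘ q = idm Y].

Definition idempotent_complete (C : preaddCat) :=
  forall (X : C) (e : hom X X), e ∘ e = e ->
    exists (Y : C) (r : hom X Y) (s : hom Y X), r ∘ s = idm Y /\ s ∘ r = e.

Record functor (C D : preaddCat) := Functor {
  fobj :> C -> D;
  fmap : forall X Y, hom X Y -> hom (fobj X) (fobj Y);
  fmapD : forall X Y (f g : hom X Y), fmap (f + g) = fmap f + fmap g;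
  fmap1 : forall X, fmap (idm X) = idm (fobj X);
  fmapM : forall X Y Z (g : hom Y Z) (f : hom X Y),
    fmap (g ∘ f) = fmap g ∘ fmap f }.

Arguments fmap {C D} F {X Y} f : rename.

Definition is_equivalence (C D : preaddCat) (F : functor C D) :=
  exists (F' : functor D C)
         (eta : forall X, hom X (F' (F X))) (eps : forall Y, hom (F (F' Y)) Y),
    [/\ forall X, is_iso (eta X),
        forall X X' (f : hom X X'), eta X' ∘ f = fmap F' (fmap F f) ∘ eta X,
        forall Y, is_iso (eps Y)
      & forall Y Y' (g : hom Y Y'), eps Y' ∘ fmap F (fmap F' g) = g ∘ eps Y].

Definition adjoint (C D : preaddCat) (L : functor C D) (R : functor D C) :=
  exists phi : forall X Y, hom (L X) Y -> hom X (R Y),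
    [/\ forall X Y, bijective (@phi X Y),
        forall X X' Y (u : hom X' X) (f : hom (L X) Y),
          phi X' Y (f ∘ fmap L u) = phi X Y f ∘ u
      & forall X Y Y' (v : hom Y Y') (f : hom (L X) Y),
          phi X Y' (v ∘ f) = fmap R v ∘ phi X Y f].

Definition triangle_class (C : preaddCat) (S : functor C C) :=
  forall X Y Z : C, hom X Y -> hom Y Z -> hom Z (S X) -> Prop.

Record triangulated (C : preaddCat) (S : functor C C)
    (dist : triangle_class S) : Prop := Triangulated {
  tr_additive : additive_cat C;
  tr_shift : is_equivalence S;
  tr_iso : forall X Y Z (f : hom X Y) (g : hom Y Z) (h : hom Z (S X))
      X' Y' Z' (f' : hom X' Y') (g' : hom Y' Z') (h' : hom Z' (S X'))
      (a : hom X X') (b : hom Y Y') (c : hom Z Z'),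
    is_iso a -> is_iso b -> is_iso c ->
    b ∘ f = f' ∘ a -> c ∘ g = g' ∘ b -> fmap S a ∘ h = h' ∘ c ->
    dist X Y Z f g h -> dist X' Y' Z' f' g' h';
  tr_id : forall X Z, is_zero Z -> dist X X Z (idm X) 0 0;
  tr_cone : forall X Y (f : hom X Y),
    exists Z (g : hom Y Z) (h : hom Z (S X)), dist X Y Z f g h;
  tr_rot : forall X Y Z (f : hom X Y) (g : hom Y Z) (h : hom Z (S X)),
    dist X Y Z f g h <-> dist Y Z (S X) g h (- fmap S f);
  tr_mor : forall X Y Z (f : hom X Y) (g : hom Y Z) (h : hom Z (S X))
      X' Y' Z' (f' : hom X' Y') (g' : hom Y' Z') (h' : hom Z' (S X'))
      (a : hom X X') (b : hom Y Y'),
    dist X Y Z f g h -> dist X' Y' Z' f' g' h' -> b ∘ f = f' ∘ a ->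
    exists c : hom Z Z', c ∘ g = g' ∘ b /\ fmap S a ∘ h = h' ∘ c;
  tr_octahedral : forall X Y Z (f : hom X Y) (g : hom Y Z)
      Z' (u : hom Y Z') (d1 : hom Z' (S X))
      Y' (v : hom Z Y') (d2 : hom Y' (S X))
      X' (w : hom Z X') (d3 : hom X' (S Y)),
    dist X Y Z' f u d1 -> dist X Z Y' (g ∘ f) v d2 -> dist Y Z X' g w d3 ->
    exists (a : hom Z' Y') (b : hom Y' X'),
      [/\ dist Z' Y' X' a b (fmap S u ∘ d3),
          a ∘ u = v ∘ g, b ∘ v = w, d2 ∘ a = d1 & d3 ∘ b = fmap S f ∘ d2] }.

Record triCat := TriCat {
  tri_cat :> preaddCat;
  shift : functor tri_cat tri_cat;
  dist : triangle_class shift;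
  triP : triangulated dist }.

Arguments shift {t}.
Arguments dist {t} [X Y Z] f g h.

Definition exact_with (T U : triCat) (F : functor T U)
    (theta : forall X, hom (F (shift X)) (shift (F X))) :=
  [/\ forall X, is_iso (theta X),
      forall X Y (f : hom X Y),
        theta Y ∘ fmap F (fmap shift f) = fmap shift (fmap F f) ∘ theta X
    & forall X Y Z (f : hom X Y) (g : hom Y Z) (h : hom Z (shift X)),
        dist f g h -> dist (fmap F f) (fmap F g) (theta X ∘ fmap F h)].

Definition is_exact (T U : triCat) (F : functor T U) :=
  exists theta : forall X, hom (F (shift X)) (shift (F X)), exact_with theta.

(* A full subcategory is the set of its objects.  The summand condition makes it
   closed under isomorphism, so that the equivalence in the shift condition is
   stability under the shift and its quasi-inverse. *)
Record is_thick (T : triCat) (N : set T) : Prop := IsThick {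
  thick_nonempty : N !=set0;
  thick_shift : forall X, N (shift X) <-> N X;
  thick_cone : forall X Y Z (f : hom X Y) (g : hom Y Z) (h : hom Z (shift X)),
    dist f g h -> N X -> N Y -> N Z;
  thick_summand : forall X Y, direct_summand X Y -> N Y -> N X }.

Record thick (T : triCat) := Thick {
  thick_set :> set T;
  thickP : is_thick thick_set }.

Definition matsui_prime (T : triCat) : set (thick T) :=
  [set P | (P : set T) `<` setT /\
    exists2 M : thick T, (P : set T) `<` M &
      forall N : thick T, (P : set T) `<` N -> (M : set T) `<=` N].

Definition Esp (T : triCat) (C : set (thick T)) : Type := {P : thick T | C P}.

Definition esp_val (T : triCat) (C : set (thick T)) (P : Esp C) : thick T :=
  proj1_sig P.

Definition esp_closed (T : triCat) (C : set (thick T)) (X : set T) :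
    set (Esp C) :=
  [set P | (esp_val P : set T) `&` X = set0].

Definition MSpc (T : triCat) : Type := Esp (@matsui_prime T).

Section CompTheory.
Variables (C : preaddCat).
Implicit Types X Y Z : C.

Lemma comp0m X Y Z (f : hom X Y) : (0 : hom Y Z) ∘ f = 0.
Proof. by apply: (addrI (0 ∘ f)); rewrite -compDl !addr0. Qed.

Lemma compm0 X Y Z (g : hom Y Z) : g ∘ (0 : hom X Y) = 0.
Proof. by apply: (addrI (g ∘ 0)); rewrite -compDr !addr0. Qed.

Lemma compNm X Y Z (g : hom Y Z) (f : hom X Y) : (- g) ∘ f = - (g ∘ f).
Proof. by apply/eqP; rewrite -addr_eq0 -compDl addNr comp0m. Qed.

Lemma compmN X Y Z (g : hom Y Z) (f : hom X Y) : g ∘ (- f) = - (g ∘ f).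
Proof. by apply/eqP; rewrite -addr_eq0 -compDr addNr compm0. Qed.

Lemma compBl X Y Z (g g' : hom Y Z) (f : hom X Y) :
  (g - g') ∘ f = g ∘ f - g' ∘ f.
Proof. by rewrite compDl compNm. Qed.

Lemma compBr X Y Z (g : hom Y Z) (f f' : hom X Y) :
  g ∘ (f - f') = g ∘ f - g ∘ f'.
Proof. by rewrite compDr compmN. Qed.

Lemma comp_suml X Y Z (I : finType) (g : I -> hom Y Z) (f : hom X Y) :
  (\sum_i g i) ∘ f = \sum_i g i ∘ f.
Proof.
apply: (big_morph (fun u : hom Y Z => u ∘ f)); last exact: comp0m.
by move=> u v; rewrite compDl.
Qed.

Lemma comp_sumr X Y Z (I : finType) (g : hom Y Z) (f : I -> hom X Y) :
  g ∘ (\sum_i f i) = \sum_i g ∘ f i.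
Proof.
apply: (big_morph (fun u : hom X Y => g ∘ u)); last exact: compm0.
by move=> u v; rewrite compDr.
Qed.

Lemma is_iso_id X : is_iso (idm X).
Proof. by exists (idm X); rewrite comp1m. Qed.

Lemma is_iso_comp X Y Z (g : hom Y Z) (f : hom X Y) :
  is_iso g -> is_iso f -> is_iso (g ∘ f).
Proof.
move=> [g' [gl gr]] [f' [fl fr]]; exists (f' ∘ g'); split.
  by rewrite -compA (compA g') gl comp1m.
by rewrite -compA (compA f) fr comp1m.
Qed.

Lemma zero_hom_l X Y (f : hom X Y) : is_zero X -> f = 0.
Proof. by rewrite /is_zero => z; rewrite -(compm1 f) z compm0. Qed.

Lemma zero_hom_r X Y (f : hom X Y) : is_zero Y -> f = 0.
Proof. by rewrite /is_zero => z; rewrite -(comp1m f) z comp0m. Qed.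

Lemma additive_zero : additive_cat C -> exists Z : C, is_zero Z.
Proof.
move=> /(_ 'I_0 (fun i => match notF (ltn_ord i) with end)) [Z].
by exists Z; rewrite /is_zero -(bp_sum Z) big_ord0.
Qed.

End CompTheory.

Lemma fmap0 (C D : preaddCat) (F : functor C D) (X Y : C) :
  fmap F (0 : hom X Y) = 0.
Proof. by apply: (addrI (fmap F 0)); rewrite -fmapD !addr0. Qed.

Lemma fmapN (C D : preaddCat) (F : functor C D) (X Y : C) (f : hom X Y) :
  fmap F (- f) = - fmap F f.
Proof. by apply/eqP; rewrite -addr_eq0 -fmapD addNr fmap0. Qed.

Lemma fmap_sum (C D : preaddCat) (F : functor C D) (X Y : C) (I : finType)
  (f : I -> hom X Y) : fmap F (\sum_i f i) = \sum_i fmap F (f i).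
Proof. by apply: (big_morph (@fmap _ _ F X Y)); [exact: fmapD|exact: fmap0]. Qed.

Lemma fmap_iso (C D : preaddCat) (F : functor C D) (X Y : C) (f : hom X Y) :
  is_iso f -> is_iso (fmap F f).
Proof.
by move=> [g [gf fg]]; exists (fmap F g); rewrite -!fmapM gf fg !fmap1.
Qed.

Lemma fmap_zero (C D : preaddCat) (F : functor C D) (Z : C) :
  is_zero Z -> is_zero (F Z).
Proof. by rewrite /is_zero -fmap1 => ->; rewrite fmap0. Qed.

Lemma direct_summand_fmap (C D : preaddCat) (F : functor C D) (X Y : C) :
  direct_summand X Y -> direct_summand (F X) (F Y).
Proof.
move=> [Z [i [p [j [q [pi qj pj qi e]]]]]].
exists (F Z), (fmap F i), (fmap F p), (fmap F j), (fmap F q).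
by rewrite -!fmapM -fmapD pi qj pj qi e !fmap1 !fmap0.
Qed.

Section TriTheory.
Variable T : triCat.
Implicit Types X Y Z : T.

Lemma zero_ex : exists Z : T, is_zero Z.
Proof. exact: additive_zero (tr_additive (triP T)). Qed.

Lemma dist_comp0 X Y Z (f : hom X Y) (g : hom Y Z) (h : hom Z (shift X)) :
  dist f g h -> g ∘ f = 0.
Proof.
move=> d; have [O zO] := zero_ex.
have [c [<- _]] := tr_mor (triP T) (tr_id (triP T) X zO) d (erefl (f ∘ idm X)).
by rewrite compm0.
Qed.

(* The cone of the zero map Y -> X[1] is X[1] (+) Y[1]. *)
Lemma thick_biproduct (N : set T) (X : bool -> T) (B : biproduct X) :
  is_thick N -> N (X true) -> N (X false) -> N B.
Proof.
move=> tN Nt Nf; apply/(thick_shift tN).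
set A := X true in Nt *; set Y := X false in Nf *.
have tT := triP T; have [O zO] := zero_ex.
have zSO := fmap_zero shift zO.
have [W [g [h d]]] := tr_cone tT (0 : hom Y (shift A)).
have NW : N W by apply: (thick_cone tN d) => //; exact/(thick_shift tN).
have d1 Z : dist (0 : hom O Z) (idm Z) (0 : hom Z (shift O)).
  by apply/(tr_rot tT); rewrite fmap0 oppr0; exact: tr_id.
have hg : h ∘ g = 0 by move/(tr_rot tT): d => /dist_comp0.
have [r [rg _]] : exists r : hom W (shift A),
    r ∘ g = idm _ ∘ idm _ /\ fmap shift (0 : hom Y O) ∘ h = 0 ∘ r.
  by apply: (tr_mor tT d (d1 _)); rewrite !compm0.
have [s [_ hs]] : exists s : hom (shift Y) W,
    s ∘ (0 : hom O _) = g ∘ 0 /\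
    fmap shift (- idm Y) ∘ (- fmap shift (idm Y)) = h ∘ s.
  apply: (tr_mor tT _ d) => //; first exact: (proj1 (tr_rot tT _ _ _) (tr_id tT Y zO)).
  by rewrite !(comp0m, compm0).
rewrite fmapN fmap1 compNm compmN opprK comp1m in hs.
rewrite comp1m in rg.
pose t : hom W W := idm W - g ∘ r - s ∘ h + g ∘ r ∘ s ∘ h.
have t0 : t = 0.
  have tg : t ∘ g = 0.
    rewrite /t !(compDl, compNm) -!compA hg rg !compm0 compm1 comp1m.
    by rewrite subr0 addr0 subrr.
  have [u [uh _]] : exists u : hom (shift Y) W,
      u ∘ h = idm W ∘ t /\
      fmap shift (0 : hom (shift A) O) ∘ (- fmap shift (0 : hom Y (shift A)))
        = 0 ∘ u.
    by apply: (tr_mor tT _ (d1 W)); [exact: (proj1 (tr_rot tT _ _ _) d)|rewrite tg compm0].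
  rewrite comp1m in uh; rewrite -uh; suff -> : u = 0 by rewrite comp0m.
  rewrite -(compm1 u) hs compA uh /t !(compDl, compNm) -!compA -hs.
  by rewrite !compm1 comp1m (addrAC s) subrr add0r addNr.
pose j := s - g ∘ r ∘ s.
have rj : r ∘ j = 0 by rewrite /j compBr !compA rg comp1m subrr.
have hj : h ∘ j = idm _ by rewrite /j compBr !compA hg !comp0m subr0.
have e : g ∘ r + j ∘ h = idm W.
  apply/esym/eqP; rewrite -subr_eq0 -t0 /t /j compBl opprD opprB !addrA.
  by rewrite -!addrA [X in _ == _ + (_ + X)]addrC.
have b1 : fmap shift (bp_out B true) ∘ fmap shift (bp_in B true) = idm _.
  by rewrite -fmapM bp_same fmap1.
have b2 : fmap shift (bp_out B false) ∘ fmap shift (bp_in B false) = idm _.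
  by rewrite -fmapM bp_same fmap1.
have b3 : fmap shift (bp_out B true) ∘ fmap shift (bp_in B false) = 0.
  by rewrite -fmapM bp_diff// fmap0.
have b4 : fmap shift (bp_out B false) ∘ fmap shift (bp_in B true) = 0.
  by rewrite -fmapM bp_diff// fmap0.
apply: (thick_summand tN) NW; exists O.
exists (g ∘ fmap shift (bp_out B true) + j ∘ fmap shift (bp_out B false)).
exists (fmap shift (bp_in B true) ∘ r + fmap shift (bp_in B false) ∘ h).
exists 0, 0; split.
- rewrite compDl !compDr -!compA (compA r g) (compA r j) (compA h g) (compA h j).
  rewrite rg rj hg hj !(comp0m, compm0) !comp1m addr0 add0r -!fmapM -fmapD.
  by rewrite -fmap1 -(bp_sum B) big_bool.
- by rewrite comp0m zO.
- by rewrite compm0.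
- by rewrite comp0m.
- rewrite comp0m addr0 compDl !compDr -!compA.
  rewrite !(compA (fmap shift (bp_out B _)) (fmap shift (bp_in B _))).
  by rewrite b1 b2 b3 b4 !(comp0m, compm0) !comp1m addr0 add0r.
Qed.

Lemma biproduct_summand (I : finType) (X : I -> T) (B : biproduct X) (i : I) :
  direct_summand (X i) B.
Proof.
have [B'] := tr_additive (triP T) (fun k : {k | k \in predC1 i} => X (val k)).
have ne k k' : (val k == val k' :> I) = (k == k' :> {k | k \in predC1 i}) by [].
pose J : hom B' B := \sum_k bp_in B (val k) ∘ bp_out B' k.
pose Q : hom B B' := \sum_k bp_in B' k ∘ bp_out B (val k).
have QJ : Q ∘ J = idm B'.
  rewrite /Q comp_suml -(bp_sum B'); apply: eq_bigr => k _.
  rewrite /J comp_sumr (bigD1 k)//= big1 ?addr0 => [|k' kk'].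
    by rewrite -!compA (compA (bp_out B _)) bp_same comp1m.
  rewrite -!compA (compA (bp_out B _)) bp_diff ?comp0m ?compm0//.
  by rewrite ne eq_sym.
exists B', (bp_in B i), (bp_out B i), J, Q; split=> //.
- exact: bp_same.
- rewrite /J comp_sumr big1// => k _; rewrite compA bp_diff ?comp0m//.
  by rewrite eq_sym; exact: (valP k).
- rewrite /Q comp_suml big1// => k _; rewrite -compA bp_diff ?compm0//.
  exact: (valP k).
rewrite -(bp_sum B) (bigD1 i)//=; congr (_ + _).
rewrite /Q comp_sumr; transitivity (\sum_(k : {k | k \in predC1 i})
    bp_in B (val k) ∘ bp_out B (val k)).
  apply: eq_bigr => k _; rewrite /J comp_suml (bigD1 k)//= big1.
    by rewrite addr0 -!compA (compA (bp_out B' _)) bp_same comp1m.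
  move=> k' kk'; rewrite -!compA (compA (bp_out B' _)) bp_diff//.
  by rewrite comp0m compm0.
by rewrite -(big_sub (predC1 i) (fun k => bp_in B k ∘ bp_out B k)).
Qed.

End TriTheory.

Section EspTopology.
Variables (T : triCat) (C : set (thick T)).

HB.instance Definition _ := gen_eqMixin (Esp C).
HB.instance Definition _ := gen_choiceMixin (Esp C).

Definition esp_open : set (set (Esp C)) :=
  [set U | exists X : set T, ~` U = esp_closed X].

Lemma esp_openT : esp_open setT.
Proof.
exists setT; rewrite setCT; apply/esym; rewrite -subset0 => P PT.
have [A PA] := thick_nonempty (thickP (esp_val P)).
by have : set0 A by rewrite -PT.
Qed.

Lemma esp_openI : setI_closed esp_open.
Proof.
move=> U V [X UX] [Y VY].
exists [set A : T | exists (D : bool -> T) (B : biproduct D),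
  [/\ X (D true), Y (D false) & A = B :> T]].
rewrite setCI UX VY; apply/seteqP; split => P.
  move=> PXY; rewrite /esp_closed /= -subset0 => A [PB [D [B [XD YD AB]]]].
  rewrite {}AB in PB.
  have PD b : (esp_val P : set T) (D b).
    exact: thick_summand (thickP _) _ _ (biproduct_summand B b) PB.
  case: PXY => [PX|PY].
    suff : set0 (D true) by [].
    by rewrite -PX; split; [exact: PD|exact: XD].
  suff : set0 (D false) by [].
  by rewrite -PY; split; [exact: PD|exact: YD].
move=> PB; apply: contrapT => /not_orP[/eqP/set0P[A [PA XA]] /eqP/set0P[A' [PA' YA']]].
pose D (b : bool) := if b then A else A'.
have [B] := tr_additive (triP T) D.
suff : set0 (B : T) by [].
rewrite -PB; split; first exact: (thick_biproduct B (thickP (esp_val P)) PA PA').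
by exists D, B.
Qed.

Lemma esp_open_bigU (K : Type) (f : K -> set (Esp C)) :
  (forall i, esp_open (f i)) -> esp_open (\bigcup_i f i).
Proof.
move=> fo; exists [set A : T | exists i X, ~` f i = esp_closed X /\ X A].
rewrite setC_bigcup; apply/seteqP; split => P.
  move=> Pf; rewrite /esp_closed /= -subset0 => A [PA [i [X [fX XA]]]].
  by suff : set0 A by []; have := Pf i I; rewrite fX => <-.
move=> PA i _; have [X fX] := fo i; rewrite fX /esp_closed /= -subset0.
by move=> A [PA' XA]; rewrite -PA; split=> //; exists i, X.
Qed.

HB.instance Definition _ :=
  isOpenTopological.Build (Esp C) esp_openT esp_openI esp_open_bigU.

Lemma esp_closedP (Z : set (Esp C)) :
  closed Z <-> exists X : set T, Z = esp_closed X.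
Proof.
by rewrite -openC; split=> -[X XZ]; exists X; move: XZ; rewrite setCK.
Qed.

End EspTopology.

HB.instance Definition _ (T : triCat) := Topological.on (MSpc T).

Definition homeomorphism (X Y : topologicalType) (f : X -> Y) :=
  exists g : Y -> X, [/\ cancel f g, cancel g f, continuous f & continuous g].

Definition corestrict (X Y : Type) (f : X -> Y) (x : X) : range f :=
  exist _ (f x) (mem_set (imageT f x)).

(* The topology on [range f] is the subspace topology. *)
Definition immersion (X Y : topologicalType) (f : X -> Y) :=
  homeomorphism (corestrict f : X -> set_type (range f)).

(* Identifies T_a X with T_b X when a = b; used for a = (gh)k, b = g(hk). *)
Definition reindex (G : Type) (C : preaddCat) (F : G -> functor C C) (a b : G)
    (e : a = b) (X : C) : hom (F a X) (F b X) :=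
  match e in _ = b return hom (F a X) (F b X) with erefl => idm (F a X) end.

Record triAction (G : finGroupType) (T : triCat) := TriAction {
  act : G -> functor T T;
  act_theta : forall g X, hom (act g (shift X)) (shift (act g X));
  act_exact : forall g, exact_with (act_theta g);
  act_equiv : forall g, is_equivalence (act g);
  gam : forall g h X, hom (act g (act h X)) (act (g * h)%g X);
  gam_iso : forall g h X, is_iso (gam g h X);
  gam_nat : forall g h X Y (f : hom X Y),
    gam g h Y ∘ fmap (act g) (fmap (act h) f) =
    fmap (act (g * h)%g) f ∘ gam g h X;
  gam_cocycle : forall g h k X,
    gam g (h * k)%g X ∘ fmap (act g) (gam h k X) =
    reindex act (esym (mulgA g h k)) X ∘ (gam (g * h)%g k X ∘ gam g h (act k X)) }.

Section Equivariantization.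
Variables (G : finGroupType) (T : triCat) (a : triAction G T).
Local Notation "'T_[' g ]" := (act a g) (format "T_[ g ]").

Record eqvObj := EqvObj {
  eqv_obj :> T;
  eqv_phi : forall g, hom (T_[g] eqv_obj) eqv_obj;
  eqv_phi_iso : forall g, is_iso (eqv_phi g);
  eqv_phiM : forall g h,
    eqv_phi (g * h)%g ∘ gam a g h eqv_obj = eqv_phi g ∘ fmap T_[g] (eqv_phi h) }.

Arguments eqv_phi : clear implicits.

Definition eqv_pred (E E' : eqvObj) : {pred hom E E'} :=
  fun f => [forall g, f ∘ eqv_phi E g == eqv_phi E' g ∘ fmap T_[g] f].

Arguments eqv_pred : clear implicits.

Lemma eqv_predP (E E' : eqvObj) (f : hom E E') :
  reflect (forall g, f ∘ eqv_phi E g = eqv_phi E' g ∘ fmap T_[g] f)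
          (f \in eqv_pred E E').
Proof.
by apply: (iffP 'forall_eqP).
Qed.

Lemma eqv_zmod_closed (E E' : eqvObj) : zmod_closed (eqv_pred E E').
Proof.
split=> [|f f' /eqv_predP fP /eqv_predP fP']; apply/eqv_predP => g.
  by rewrite fmap0 comp0m compm0.
by rewrite fmapD fmapN compDl compDr compNm compmN fP fP'.
Qed.

HB.instance Definition _ (E E' : eqvObj) :=
  GRing.isZmodClosed.Build (hom E E') (eqv_pred E E') (eqv_zmod_closed E E').

Record eqvHom (E E' : eqvObj) := EqvHom {
  eqv_hom :> hom E E';
  eqv_homP : eqv_hom \in eqv_pred E E' }.

HB.instance Definition _ (E E' : eqvObj) := [isSub for @eqv_hom E E'].
HB.instance Definition _ (E E' : eqvObj) := [Choice of eqvHom E E' by <:].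
HB.instance Definition _ (E E' : eqvObj) :=
  [SubChoice_isSubZmodule of eqvHom E E' by <:].

Lemma eqv_id_subproof (E : eqvObj) : idm (E : T) \in eqv_pred E E.
Proof. by apply/eqv_predP => g; rewrite fmap1 comp1m compm1. Qed.

Definition eqv_id (E : eqvObj) : eqvHom E E := EqvHom (eqv_id_subproof E).

Lemma eqv_comp_subproof (E E' E'' : eqvObj) (g : eqvHom E' E'') (f : eqvHom E E') :
  (g : hom _ _) ∘ f \in eqv_pred E E''.
Proof.
apply/eqv_predP => k; rewrite fmapM -compA.
move/eqv_predP: (eqv_homP f) => ->; rewrite compA.
by move/eqv_predP: (eqv_homP g) => ->; rewrite compA.
Qed.

Definition eqv_comp (E E' E'' : eqvObj) (g : eqvHom E' E'') (f : eqvHom E E') :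
  eqvHom E E'' := EqvHom (eqv_comp_subproof g f).

Definition eqv_cat : preaddCat.
Proof.
apply: (@PreaddCat eqvObj (fun E E' => eqvHom E E') eqv_id eqv_comp).
- by move=> E E' f; apply: val_inj; rewrite /= comp1m.
- by move=> E E' f; apply: val_inj; rewrite /= compm1.
- by move=> E1 E2 E3 E4 h g f; apply: val_inj; rewrite /= compA.
- by move=> E1 E2 E3 g g' f; apply: val_inj; rewrite /= compDl.
- by move=> E1 E2 E3 g f f'; apply: val_inj; rewrite /= compDr.
Defined.

Definition forget : functor eqv_cat T.
Proof.
apply: (@Functor eqv_cat T (fun E : eqvObj => E : T)
  (fun E E' (f : eqvHom E E') => eqv_hom f)); by [].
Defined.

(* The gam g h commute with the shift isomorphisms of the exact functors T_g. This
   is what makes the natural maps T_g(E[1]) -> (T_g E)[1] -> E[1] of eqv_shift_obj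
   an equivariant structure. *)
Definition gam_shift :=
  forall g h (X : T),
    act_theta a (g * h)%g X ∘ gam a g h (shift X) =
    fmap shift (gam a g h X) ∘
      (act_theta a g (T_[h] X) ∘ fmap T_[g] (act_theta a h X)).

Section InducedShift.
Hypothesis gs : gam_shift.

Definition eqv_shift_obj (E : eqvObj) : eqvObj.
Proof.
apply: (@EqvObj (shift E)
  (fun g => fmap shift (eqv_phi E g) ∘ act_theta a g E)) => [g|g h].
  apply: is_iso_comp; last by case: (act_exact a g).
  exact/fmap_iso/eqv_phi_iso.
rewrite -compA gs compA -fmapM eqv_phiM !fmapM.
have [_ nat _] := act_exact a g.
rewrite -!compA; congr (_ ∘ _); rewrite !compA; congr (_ ∘ _).
exact/esym/nat.
Defined.

Lemma eqv_shift_subproof (E E' : eqvObj) (f : eqvHom E E') :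
  fmap shift (f : hom _ _) \in eqv_pred (eqv_shift_obj E) (eqv_shift_obj E').
Proof.
apply/eqv_predP => g /=; have [_ nat _] := act_exact a g.
rewrite compA -fmapM; move/eqv_predP: (eqv_homP f) => ->.
by rewrite fmapM -!compA; congr (_ ∘ _); rewrite nat.
Qed.

Definition eqv_shift : functor eqv_cat eqv_cat.
Proof.
apply: (@Functor eqv_cat eqv_cat eqv_shift_obj
  (fun E E' f => EqvHom (eqv_shift_subproof f))).
- by move=> E E' f g; apply: val_inj; rewrite /= fmapD.
- by move=> E; apply: val_inj; rewrite /= fmap1.
- by move=> E E' E'' g f; apply: val_inj; rewrite /= fmapM.
Defined.

Definition eqv_dist : triangle_class eqv_shift :=
  fun (X Y Z : eqvObj) f g h =>
    dist (eqv_hom f) (eqv_hom g) (eqv_hom h : hom Z (shift X)).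

Definition eqv_triCat (t : triangulated eqv_dist) : triCat := TriCat t.

Lemma eqv_thick_subproof (t : triangulated eqv_dist) (P : thick T) :
  is_thick ([set E | (P : set T) (forget E)] : set (eqv_triCat t)).
Proof.
have tP := thickP P; split.
- have [O zO] := @zero_ex (eqv_triCat t); have [A PA] := thick_nonempty tP.
  have zFO := fmap_zero forget zO.
  exists O; apply: (thick_summand tP) PA.
  exists A, 0, 0, (idm A), (idm A).
  rewrite !(comp0m, compm0) comp1m add0r; split=> //.
- by move=> E; exact: (thick_shift tP).
- by move=> E E' E'' f g h d; exact: (thick_cone tP d).
- move=> E E' /(direct_summand_fmap forget); exact: (thick_summand tP).
Qed.

Definition eqv_thick (t : triangulated eqv_dist) (P : thick T) :
  thick (eqv_triCat t) := Thick (eqv_thick_subproof t P).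

End InducedShift.

Section Induction.
(* Ind is defined relative to a choice of the direct sums of the T_g A. *)
Variable ds : forall A : T, biproduct (fun g : G => T_[g] A).

(* The component of index g of gamma is from T_h T_{h^-1 g} A to T_g A: it is
   written here with m = h^-1 g. *)
Definition ind_tau (A : T) (h : G) : hom (T_[h] (ds A)) (ds A) :=
  \sum_(m : G) bp_in (ds A) (h * m)%g ∘
    (gam a h m A ∘ fmap T_[h] (bp_out (ds A) m)).

Definition ind_map (A B : T) (f : hom A B) : hom (ds A) (ds B) :=
  \sum_(m : G) bp_in (ds B) m ∘ (fmap T_[m] f ∘ bp_out (ds A) m).

Lemma bp_out_inj (A X : T) (u v : hom X (ds A)) :
  (forall m, bp_out (ds A) m ∘ u = bp_out (ds A) m ∘ v) -> u = v.
Proof.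
move=> uv; rewrite -(comp1m u) -(comp1m v) -bp_sum !comp_suml.
by apply: eq_bigr => m _; rewrite -!compA uv.
Qed.

Lemma ind_tauE (A : T) (h m : G) :
  bp_out (ds A) (h * m)%g ∘ ind_tau A h =
  gam a h m A ∘ fmap T_[h] (bp_out (ds A) m).
Proof.
rewrite comp_sumr (bigD1 m)//= big1 ?addr0 => [|k km].
  by rewrite compA bp_same comp1m.
rewrite compA bp_diff ?comp0m//.
by apply: contra km => /eqP/mulgI ->.
Qed.

Lemma ind_mapE (A B : T) (f : hom A B) (m : G) :
  bp_out (ds B) m ∘ ind_map f = fmap T_[m] f ∘ bp_out (ds A) m.
Proof.
rewrite comp_sumr (bigD1 m)//= big1 ?addr0 => [|k km].
  by rewrite compA bp_same comp1m.
by rewrite compA bp_diff ?comp0m// eq_sym.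
Qed.

Lemma reindex_out (A : T) (k k' : G) (e : k = k') :
  reindex (act a) e A ∘ bp_out (ds A) k = bp_out (ds A) k'.
Proof. by case: k' / e => /=; rewrite comp1m. Qed.

Lemma reindexK (A : T) (k k' : G) (e : k = k') :
  reindex (act a) e A ∘ reindex (act a) (esym e) A = idm _.
Proof. by case: k' / e => /=; rewrite comp1m. Qed.

Lemma ind_tau_iso (A : T) (h : G) : is_iso (ind_tau A h).
Proof.
pose gi m := projT1 (cid (gam_iso a h m A)).
have giP m : gi m ∘ gam a h m A = idm _ /\ gam a h m A ∘ gi m = idm _.
  exact: (projT2 (cid (gam_iso a h m A))).
exists (\sum_m fmap T_[h] (bp_in (ds A) m) ∘ (gi m ∘ bp_out (ds A) (h * m)%g)).
split.
  rewrite comp_suml -fmap1 -(bp_sum (ds A)) fmap_sum; apply: eq_bigr => m _.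
  rewrite -!compA ind_tauE (compA (gi m)); have [-> _] := giP m.
  by rewrite comp1m fmapM.
rewrite comp_sumr -(bp_sum (ds A)).
rewrite [RHS](reindex_inj (mulgI h)); apply: eq_bigr => m _ /=.
rewrite !compA; congr (_ ∘ _); apply: bp_out_inj => k.
rewrite -(mulKVg h k); move: (h^-1 * k)%g => {}k.
rewrite !compA ind_tauE -(compA (gam _ _ _ _)) -fmapM.
have [->|km] := eqVneq k m.
  by rewrite !bp_same fmap1 compm1; have [_ ->] := giP m.
rewrite !bp_diff// ?fmap0 ?compm0 ?comp0m//.
by apply: contra km => /eqP/mulgI ->.
Qed.

Lemma ind_tauM (A : T) (g h : G) :
  ind_tau A (g * h)%g ∘ gam a g h (ds A) = ind_tau A g ∘ fmap T_[g] (ind_tau A h).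
Proof.
apply: bp_out_inj => k; rewrite -(mulKVg (g * h)%g k).
move: ((g * h)^-1 * k)%g => {}k.
rewrite !compA ind_tauE -[LHS]compA -gam_nat.
rewrite -(reindex_out A (mulgA g h k)) -[_ ∘ bp_out _ _ ∘ _]compA ind_tauE.
rewrite -!compA -fmapM ind_tauE fmapM (compA (gam a g _ A)) gam_cocycle !compA.
by rewrite reindexK comp1m.
Qed.

Definition ind_obj (A : T) : eqvObj :=
  EqvObj (ind_tau_iso A) (ind_tauM A).

Lemma ind_map_subproof (A B : T) (f : hom A B) :
  ind_map f \in eqv_pred (ind_obj A) (ind_obj B).
Proof.
apply/eqv_predP => h /=; apply: bp_out_inj => k; rewrite -(mulKVg h k).
move: (h^-1 * k)%g => {}k; rewrite !compA ind_mapE ind_tauE -!compA.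
by rewrite ind_tauE -fmapM ind_mapE fmapM !compA gam_nat.
Qed.

Definition Ind : functor T eqv_cat.
Proof.
apply: (@Functor T eqv_cat ind_obj
  (fun A B f => EqvHom (ind_map_subproof f))).
- move=> A B f g; apply/val_inj/bp_out_inj => m /=.
  by rewrite compDr !ind_mapE fmapD compDl.
- move=> A; apply/val_inj/bp_out_inj => m /=.
  by rewrite ind_mapE fmap1 comp1m compm1.
- move=> A B D g f; apply/val_inj/bp_out_inj => m /=.
  by rewrite ind_mapE compA ind_mapE -compA ind_mapE fmapM compA.
Defined.

End Induction.

Definition G_invariant (N : set T) := forall g X, N X -> N (T_[g] X).

Definition G_matsui_prime : set (thick T) :=
  [set P | matsui_prime P /\ G_invariant P].

Definition MSpc_G : Type := Esp G_matsui_prime.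

HB.instance Definition _ := Topological.on MSpc_G.

End Equivariantization.

Arguments eqv_phi {G T a} e g.
Arguments eqv_dist {G T a} gs [X Y Z] f g h : rename.

Definition ind_closed (G : finGroupType) (T : triCat) (a : triAction G T)
    (ds : forall A : T, biproduct (fun g : G => act a g A))
    (J : set (eqv_cat a)) :=
  forall E, J E -> J (Ind ds (forget a E)).

(* Main.v *)
(** For a G-invariant thick P, an object A lies in P iff Ind A lies in P^G, since
    the object underlying Ind A is the sum of the T_g A and T_1 A is isomorphic
    to A.  Hence F and Ind carry the test classes of the two topologies to each
    other, which makes P |-> P^G an immersion.  If M is the least thick
    subcategory strictly above a G-Matsui prime P, then M is G-invariant, and M^G
    is least above P^G: for J strictly above P^G, the thick subcategory
    Ind^-1(J) is strictly above P because J is Ind-closed, so it contains M, and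
    every E in M^G is a summand of Ind (F E), hence lies in J. *)

Require Import Defs.
From HB Require Import structures.
From mathcomp Require Import all_boot all_algebra fingroup.
From mathcomp Require Import boolp classical_sets topology.
Local Open Scope classical_set_scope.

Set Implicit Arguments.
Unset Strict Implicit.
Unset Printing Implicit Defensive.

(* Restores [hom] and [fmap], which the libraries above shadow. *)
Import GRing.Theory Defs.

(** * Immersions and homeomorphisms of topological spaces *)

Section Topology.
Variables (X Y : topologicalType) (f : X -> Y).

Lemma immersion_of_inducing : injective f -> continuous f ->
  (forall A : set X, closed A -> exists2 B : set Y, closed B & A = f @^-1` B) ->
  immersion f.
Proof.
move=> finj fcont find.
pose g (y : set_type (range f)) : X := projT1 (cid2 (set_mem (valP y))).
have gE y : f (g y) = val y by rewrite /g; case: cid2.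
have fK : cancel (corestrict f) g by move=> x; apply: finj; rewrite gE.
exists g; split=> //.
- by move=> y; apply: val_inj; rewrite /= gE.
- apply/continuousP => B [V Vo <-].
  by rewrite -comp_preimage; move/continuousP: fcont; apply.
- apply/continuous_closedP => A /find[B Bc ->].
  have -> : g @^-1` (f @^-1` B) = val @^-1` B.
    by apply/seteqP; split=> y /=; rewrite gE.
  exact: (proj1 (continuous_closedP _) (@initial_continuous _ _ _)).
Qed.

(** By surjectivity, [c] identifies [Y] with the range of [f]. An open set of the range is the trace
    of an open [B], and [c] pulls it back to [B] itself. *)
Lemma homeomorphism_of_immersion :
  immersion f -> (forall y, exists x, f x = y) -> homeomorphism f.
Proof.
move=> [g [fK gK fcont gcont]] fsurj.
have inR y : y \in range f by have [x <-] := fsurj y; exact/mem_set/imageT.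
pose c y : set_type (range f) := exist _ y (inR y).
have cf x : c (f x) = corestrict f x by exact: val_inj.
exists (g \o c); split=> [x|y||].
- by rewrite /= cf fK.
- by have := congr1 val (gK (c y)).
- move=> x; apply: (@continuous_comp _ _ _ (corestrict f) val x (fcont x)).
  exact: initial_continuous.
- apply/continuousP => A Ao.
  have [B Bo BE] : open (g @^-1` A) by move/continuousP: gcont; apply.
  suff -> : (g \o c) @^-1` A = B by [].
  by rewrite comp_preimage -BE; apply/seteqP; split.
Qed.

End Topology.

(** * Immersions between spaces of thick subcategories *)

Lemma thick_disjoint_image (T U : triCat) (P : thick T) (Q : thick U)
    (s : T -> U) :
  (forall X, (P : set T) X <-> (Q : set U) (s X)) ->
  forall X : set T, (P : set T) `&` X = set0 <-> (Q : set U) `&` (s @` X) = set0.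
Proof.
move=> PQ X; split=> PX; rewrite -subset0.
  move=> Y [QY [A XA AY]]; subst Y; have /PQ PA := QY.
  by suff : set0 A by []; rewrite -PX.
move=> A [/PQ QA XA]; suff : set0 (s A) by [].
by rewrite -PX; split=> //; exists A.
Qed.

Section Espace.
Variables (T U : triCat) (C : set (thick T)) (D : set (thick U)).

Lemma thick_ext (P Q : thick T) : (P : set T) = Q -> P = Q.
Proof.
move: P Q => [P tP] [Q tQ] /= PQ; subst Q.
by congr Thick; exact: Prop_irrelevance.
Qed.

Lemma esp_val_inj : injective (@esp_val T C).
Proof.
by move=> [P CP] [Q CQ] /= PQ; subst Q; congr exist; exact: Prop_irrelevance.
Qed.

(** Closed sets are given by test classes. Pulling classes back along [r] gives continuity; pushing
    them forward along [s] shows every closed set to be a preimage. Injectivity follows as [phi P]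
    determines [P] through [s]. *)
Lemma esp_immersion (phi : Esp C -> Esp D) (s : T -> U) (r : U -> T) :
  (forall P X, (esp_val P : set T) X <-> (esp_val (phi P) : set U) (s X)) ->
  (forall P Y, (esp_val (phi P) : set U) Y <-> (esp_val P : set T) (r Y)) ->
  immersion phi.
Proof.
move=> sP rP; apply: immersion_of_inducing.
- move=> P Q PQ; apply/esp_val_inj/thick_ext/seteqP.
  by split=> X /sP; [rewrite PQ|rewrite -PQ] => /sP.
- apply/continuous_closedP => B /esp_closedP[Y ->].
  apply/esp_closedP; exists (r @` Y); apply/seteqP.
  by split=> P; case: (thick_disjoint_image (rP P) Y).
- move=> A /esp_closedP[X ->]; exists (@esp_closed _ D (s @` X)).
    by apply/esp_closedP; exists (s @` X).
  by apply/seteqP; split=> P; case: (thick_disjoint_image (sP P) X).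
Qed.

End Espace.

(** * Isomorphism of objects and closure properties of thick subcategories *)

Section Isomorphic.
Local Open Scope cat_scope.

Definition isomorphic (C : preaddCat) (X Y : C) := exists f : hom X Y, is_iso f.

Lemma isomorphic_sym (C : preaddCat) (X Y : C) : isomorphic X Y -> isomorphic Y X.
Proof. by move=> [f [g [gf fg]]]; exists g, f. Qed.

Lemma isomorphic_trans (C : preaddCat) (Y X Z : C) :
  isomorphic X Y -> isomorphic Y Z -> isomorphic X Z.
Proof. by move=> [f fi] [g gi]; exists (g ∘ f); exact: is_iso_comp. Qed.

Lemma isomorphic_fmap (C D : preaddCat) (F : functor C D) (X Y : C) :
  isomorphic X Y -> isomorphic (F X) (F Y).
Proof. by move=> [f fi]; exists (fmap F f); exact: fmap_iso. Qed.

End Isomorphic.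

Section Thick.
Local Open Scope ring_scope.
Local Open Scope cat_scope.

Lemma isomorphic_summand (T : triCat) (X Y : T) :
  isomorphic X Y -> direct_summand X Y.
Proof.
move=> [f [g [gf fg]]]; have [O zO] := zero_ex T.
exists O, f, g, 0, 0.
by rewrite !(comp0m, compm0) fg gf zO addr0.
Qed.

Lemma thick_isomorphic (T : triCat) (P : thick T) (X Y : T) :
  isomorphic X Y -> (P : set T) X <-> (P : set T) Y.
Proof.
move=> XY; have YX := isomorphic_sym XY.
by split; apply: (thick_summand (thickP P)); exact: isomorphic_summand.
Qed.

Lemma thick_zero (T : triCat) (P : thick T) (Z : T) : is_zero Z -> (P : set T) Z.
Proof.
move=> zZ; have [A PA] := thick_nonempty (thickP P).
apply: (thick_summand (thickP P)) PA; exists A, 0, 0, (idm A), (idm A).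
by rewrite !(comp0m, compm0, comp1m) add0r.
Qed.

(** The complement of [X] is the image of the idempotent [idm Y - s ∘ r], which splits. *)
Lemma retract_summand (C : preaddCat) (X Y : C) (r : hom Y X) (s : hom X Y) :
  idempotent_complete C -> r ∘ s = idm X -> direct_summand X Y.
Proof.
move=> /(_ Y (idm Y - s ∘ r)) + rs.
have rN : r ∘ (idm Y - s ∘ r) = 0 by rewrite compBr compm1 compA rs comp1m subrr.
have Ns : (idm Y - s ∘ r) ∘ s = 0 by rewrite compBl comp1m -compA rs compm1 subrr.
have NN : (idm Y - s ∘ r) ∘ (idm Y - s ∘ r) = idm Y - s ∘ r.
  by rewrite compBl comp1m -compA rN compm0 subr0.
move=> /(_ NN)[Z [q [j [qj jq]]]]; exists Z, s, r, j, q; split=> //.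
- by rewrite -(compm1 j) -qj (compA j) jq compA rN comp0m.
- by rewrite -(comp1m q) -qj -(compA q) jq -compA Ns compm0.
- by rewrite jq addrC subrK.
Qed.

Lemma thick_finite_biproduct (T : triCat) (P : thick T) (I : finType)
    (X : I -> T) (B : biproduct X) : idempotent_complete T ->
  (forall i, (P : set T) (X i)) -> (P : set T) B.
Proof.
move=> icT PX.
(* By induction on the list of indices, each partial sum of the projectors of [B] factors through an
   object of [P]. The full sum is the identity, so [B] is a retract of such an object. *)
suff [Y PY [f [g gf]]] : exists2 Y, (P : set T) Y &
    exists (f : hom B Y) (g : hom Y B),
      g ∘ f = \sum_(i <- enum I) bp_in B i ∘ bp_out B i.
  apply: (thick_summand (thickP P)) PY.
  apply: (retract_summand (r := g) (s := f) icT).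
  by rewrite gf big_enum /= bp_sum.
elim: (enum I) => [|i s [Y PY [f [g gf]]]].
  have [A PA] := thick_nonempty (thickP P); exists A => //.
  by exists 0, 0; rewrite big_nil comp0m.
have [B'] := tr_additive (triP T) (fun b : bool => if b then X i else Y).
exists B'; first exact: (thick_biproduct B' (thickP P) (PX i) PY).
exists (bp_in B' true ∘ bp_out B i + bp_in B' false ∘ f).
exists (bp_in B i ∘ bp_out B' true + g ∘ bp_out B' false).
rewrite big_cons -gf compDl !compDr -!compA.
rewrite !(compA (bp_out B' true)) !(compA (bp_out B' false)).
rewrite (bp_same B' true) (bp_same B' false).
rewrite (@bp_diff _ _ _ B' true false isT) (@bp_diff _ _ _ B' false true isT).
by rewrite !(comp0m, compm0, comp1m) addr0 add0r.
Qed.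

Lemma exact_preimage_subproof (T U : triCat) (F : functor T U) (P : thick U) :
  is_exact F -> is_thick [set X | (P : set U) (F X)].
Proof.
move=> [theta [theta_iso _ theta_dist]]; split.
- have [O zO] := zero_ex T; exists O; exact/thick_zero/fmap_zero.
- move=> X; apply: iff_trans (thick_shift (thickP P) (F X)).
  apply: thick_isomorphic.
  by exists (theta X).
- by move=> X Y Z f g h /theta_dist d; exact: (thick_cone (thickP P) d).
- by move=> X Y /(direct_summand_fmap F); exact: (thick_summand (thickP P)).
Qed.

Definition exact_preimage (T U : triCat) (F : functor T U) (F_exact : is_exact F)
  (P : thick U) : thick T := Thick (exact_preimage_subproof P F_exact).

End Thick.

(** * The action on objects and the invariance of thick subcategories *)

Section Action.
Variables (G : finGroupType) (T : triCat) (a : triAction G T).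

(** The isomorphism [gam a 1 1] relates T_1 T_1 X to T_1 X, and a quasi-inverse [F] of T_1 cancels
    one T_1 on both sides. *)
Lemma act1_isomorphic (X : T) : isomorphic (act a 1%g X) X.
Proof.
have [F [eta [_ [eta_iso _ _ _]]]] := act_equiv a 1%g.
have etaP Y : isomorphic Y (F (act a 1%g Y)) by exists (eta Y).
apply: (isomorphic_trans (etaP _)); apply: isomorphic_trans (isomorphic_sym (etaP X)).
apply: isomorphic_fmap; rewrite -[X in isomorphic _ (act a X _)]mulg1.
by exists (gam a 1%g 1%g X); exact: gam_iso.
Qed.

Lemma actVK_isomorphic (g : G) (X : T) :
  isomorphic (act a g^-1%g (act a g X)) X.
Proof.
apply: isomorphic_trans (act1_isomorphic X); rewrite -(mulVg g).
by exists (gam a g^-1%g g X); exact: gam_iso.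
Qed.

Lemma act_is_exact (g : G) : is_exact (act a g).
Proof. by exists (@act_theta _ _ a g); exact: act_exact. Qed.

Lemma G_invariantE (P : thick T) (g : G) (X : T) :
  G_invariant a P -> (P : set T) (act a g X) <-> (P : set T) X.
Proof.
move=> Pinv; split; last exact: Pinv.
by move=> /(Pinv g^-1%g) /(thick_isomorphic P (actVK_isomorphic g X)).
Qed.

(* [M] is contained in each of its preimages under the [T_g], since these also
   contain [P] strictly. *)
Lemma G_invariant_least (P M : thick T) : G_invariant a P ->
  (P : set T) `<` M ->
  (forall N : thick T, (P : set T) `<` N -> (M : set T) `<=` N) ->
  G_invariant a M.
Proof.
move=> Pinv [PM MP] Mmin g.
apply: (Mmin (exact_preimage (act_is_exact g) M)).
split=> [X PX|MgP]; first exact/PM/Pinv.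
(* For [X] in [M], the object T_{g^-1} X lies in the preimage of [M] under T_g, hence in [P], and so
   does [X]. *)
apply: MP => X MX; apply/(G_invariantE g^-1%g _ Pinv).
apply: MgP; have := actVK_isomorphic g^-1%g X; rewrite invgK => gVK.
exact/(thick_isomorphic M gVK).
Qed.

End Action.

(** * From G-Matsui primes to Matsui primes of the equivariantization *)

Section Equivariant.
Variables (G : finGroupType) (T : triCat) (a : triAction G T).
Variable ds : forall A : T, biproduct (fun g : G => act a g A).
Variables (gs : gam_shift a) (tG : triangulated (eqv_dist gs)).
Hypothesis icT : idempotent_complete T.

Lemma eqv_thick_Ind (P : thick T) (A : T) : G_invariant a P ->
  (eqv_thick tG P : set (eqv_triCat tG)) (Ind ds A) <-> (P : set T) A.
Proof.
move=> Pinv; split=> [PA|PA] /=.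
  apply/(G_invariantE 1%g A Pinv); apply: (thick_summand (thickP P)) PA.
  exact: (biproduct_summand (ds A) 1%g).
by apply: (thick_finite_biproduct (ds A) icT) => g; exact: Pinv.
Qed.

Hypothesis Ind_exact : is_exact (Ind ds : functor T (eqv_triCat tG)).
Hypothesis summand_Ind :
  forall E : eqv_cat a, direct_summand E (Ind ds (forget a E)).
Hypothesis thick_Ind_closed :
  forall J : thick (eqv_triCat tG), ind_closed ds J.

Lemma matsui_prime_eqv_thick (P : thick T) :
  G_matsui_prime a P -> matsui_prime (eqv_thick tG P).
Proof.
move=> [[[_ PT] [M [PM MP] Mmin]] Pinv].
have Minv : G_invariant a M := G_invariant_least Pinv (conj PM MP) Mmin.
split.
  split=> // TP; apply: PT => A _; apply/(eqv_thick_Ind A Pinv); exact: TP.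
exists (eqv_thick tG M).
  split=> [E|MGP]; first exact: PM.
  apply: MP => A MA; apply/(eqv_thick_Ind A Pinv); apply: MGP.
  exact/eqv_thick_Ind.
move=> J [PJ JP] E ME; apply: (thick_summand (thickP J)) (summand_Ind E) _.
apply: (Mmin (exact_preimage Ind_exact J)) ME; split=> [A PA|NP].
  exact/PJ/eqv_thick_Ind.
(* Were Ind^-1(J) inside [P], every [F] in [J] would have its underlying object in [P], as Ind of
   that object is in [J]; then [J] would lie in P^G. *)
by apply: JP => F JF; apply: NP; exact: thick_Ind_closed.
Qed.

End Equivariant.

(** * The immersion and the criterion for it to be a homeomorphism *)

Theorem corollary6p16 (G : finGroupType) (T : triCat) (a : triAction G T)
  (ds : forall A : T, biproduct (fun g : G => act a g A))
  (T_idempotent_complete : idempotent_complete T)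
  (gs : gam_shift a)
  (tG : triangulated (eqv_dist gs))
  (Ind_exact : is_exact (Ind ds : functor T (eqv_triCat tG)))
  (forget_exact : is_exact (forget a : functor (eqv_triCat tG) T))
  (Ind_forget : adjoint (Ind ds) (forget a))
  (forget_Ind : adjoint (forget a) (Ind ds))
  (summand_Ind : forall E : eqv_cat a, direct_summand E (Ind ds (forget a E)))
  (thick_Ind_closed : forall J : thick (eqv_triCat tG), ind_closed ds J) :
  exists (f : MSpc_G a -> Esp (eqv_thick tG @` G_matsui_prime a))
         (j : Esp (eqv_thick tG @` G_matsui_prime a) -> MSpc (eqv_triCat tG)),
    [/\ (forall P, esp_val (f P) = eqv_thick tG (esp_val P)) /\ homeomorphism f,
        (forall Q, esp_val (j Q) = esp_val Q) /\ immersion j,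
        immersion (j \o f)
      & homeomorphism (j \o f) <->
        (forall Q : thick (eqv_triCat tG), matsui_prime Q ->
           exists2 P : thick T, G_matsui_prime a P & Q = eqv_thick tG P)].
Proof.
pose f (P : MSpc_G a) : Esp (eqv_thick tG @` G_matsui_prime a) :=
  exist _ (eqv_thick tG (esp_val P)) (imageP _ (proj2_sig P)).
have CG_prime Q : (eqv_thick tG @` G_matsui_prime a) Q -> matsui_prime Q.
  move=> [P PP <-].
  exact: (matsui_prime_eqv_thick T_idempotent_complete Ind_exact).
pose j (Q : Esp (eqv_thick tG @` G_matsui_prime a)) : MSpc (eqv_triCat tG) :=
  exist _ (esp_val Q) (CG_prime _ (proj2_sig Q)).
have IndE (P : MSpc_G a) A : (esp_val P : set T) A <->
    (eqv_thick tG (esp_val P) : set (eqv_triCat tG)) (Ind ds A).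
  by rewrite eqv_thick_Ind //; case: P => P [].
have fimm : immersion f by apply: (@esp_immersion _ _ _ _ f (Ind ds) (forget a)).
have jfimm : immersion (j \o f).
  by apply: (@esp_immersion _ _ _ _ (j \o f) (Ind ds) (forget a)).
exists f, j; split=> //; split=> //.
- apply: homeomorphism_of_immersion => // -[Q [P PP PQ]].
  by exists (exist _ P PP); exact: esp_val_inj.
(* [j] keeps the underlying subcategory, so test classes are carried over unchanged. *)
- exact: (@esp_immersion _ _ _ _ j id id).
(* The inverse homeomorphism supplies the prime [P] with P^G equal to [Q]. *)
- move=> [g [_ gK _ _]] Q Qprime; pose P := g (exist _ Q Qprime).
  exists (esp_val P); first exact: (proj2_sig P).
  exact: (esym (congr1 (@esp_val _ _) (gK (exist _ Q Qprime)))).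
- move=> allP; apply: homeomorphism_of_immersion => // -[Q Qprime].
  have [P PP QP] := allP Q Qprime.
  by exists (exist _ P PP); exact/esp_val_inj/esym.
Qed.
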